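(* Let $S$ be a finite set of primes. Let $U\subset\mathbb{R}^n$ be a connected open set and $f_1,\dots,f_d:U\to\mathbb{R}$ real analytic functions which together with $1$ are linearly independent over $\mathbb{R}$. Then for every $\varepsilon>0$ and Lebesgue almost every $u\in U$, $$\max_{1\le i\le d}|qf_i(u)-p_i|\ge q^{-\varepsilon}$$ for all $(p_1,\dots,p_d,q)\in\mathbb{Z}^{d+1}$ such that all prime factors of $q$ lie in $S$, with finitely many exceptions. *)

(* Defs.v *)
From mathcomp Require Import all_boot all_order all_algebra.
From mathcomp Require Import all_classical all_reals all_analysis.
From mathcomp Require analysis.showcase.summability.
Set Implicit Arguments.
Unset Strict Implicit.
Unset Printing Implicit Defensive.
Import Order.TTheory GRing.Theory Num.Theory.
Import numFieldNormedType.Exports.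
Local Open Scope classical_set_scope.
Local Open Scope ring_scope.

(* R^n is 'rV[R]_n, with its product topology. *)

(* A multi-index is an element of {ffun 'I_n -> nat}.  The power series is an
   unordered sum: its finite partial sums converge along the filter of finite
   sets of multi-indices, which in R is the same as absolute convergence.
   As U is open in all uses, the neighbourhoods of a can be taken inside U, so
   the values of f outside U are irrelevant. *)
Definition real_analytic_on (R : realType) (n : nat) (U : set 'rV[R]_n)
    (f : 'rV[R]_n -> R) : Prop :=
  forall a : 'rV[R]_n, U a ->
  exists c : {ffun 'I_n -> nat} -> R,
    nbhs a [set x : 'rV[R]_n |
      summability.partial_sum
        (fun k : {ffun 'I_n -> nat} =>
           c k * \prod_(i < n) (x ord0 i - a ord0 i) ^+ k i)
        @ summability.totally --> f x].

Definition lin_indep_with_1 (R : realType) (n d : nat) (U : set 'rV[R]_n)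
    (f : 'I_d -> 'rV[R]_n -> R) : Prop :=
  forall (c0 : R) (c : 'I_d -> R),
    (forall u, U u -> c0 + \sum_(i < d) c i * f i u = 0) ->
    c0 = 0 /\ forall i, c i = 0.

Definition box (R : realType) (n : nat) (a b : 'rV[R]_n) : set 'rV[R]_n :=
  [set x | forall i, a ord0 i <= x ord0 i <= b ord0 i].

Definition box_volume (R : realType) (n : nat) (a b : 'rV[R]_n) : R :=
  \prod_(i < n) Num.max 0 (b ord0 i - a ord0 i).

(* The infimum is over covers by a finite or countable family of boxes, indexed
   by a set D of natural numbers. *)
Definition lebesgue_outer_measure (R : realType) (n : nat)
    (X : set 'rV[R]_n) : \bar R :=
  ereal_inf [set v | exists (D : set nat) (a b : nat -> 'rV[R]_n),
    X `<=` \bigcup_(k in D) box (a k) (b k) /\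
    v = (\esum_(k in D) (box_volume (a k) (b k))%:E)%E].

Definition lebesgue_ae_on (R : realType) (n : nat) (U : set 'rV[R]_n)
    (P : 'rV[R]_n -> Prop) : Prop :=
  lebesgue_outer_measure (U `&` [set u | ~ P u]) = 0%E.

(* Every prime divides 0, so when S is a finite set this excludes q = 0. *)
Definition prime_factors_in (S : set nat) (q : int) : Prop :=
  forall l : nat, prime l -> (l %| `|q|)%N -> S l.

(* Main.v *)
Require Import Defs.
From mathcomp Require Import all_boot all_order all_algebra.
From mathcomp Require Import all_classical all_reals all_analysis.
From mathcomp Require Import ring lra zify.
Set Implicit Arguments.
Unset Strict Implicit.
Unset Printing Implicit Defensive.
Import Order.TTheory GRing.Theory Num.Theory.
Import numFieldNormedType.Exports.
Local Open Scope classical_set_scope.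
Local Open Scope ring_scope.

(* A single coordinate function [f] is enough.  The series of [|q| ^ (- eps)]
   over the [S]-smooth integers [q] is a finite product of geometric series, so
   by Borel-Cantelli the set [N] of the reals [y] with [|q y - p| < |q| ^ (- eps)]
   for infinitely many such [q] is Lebesgue null.  It remains to see that a
   nonconstant analytic [f] pulls null sets back to null sets.  Near a point
   where some partial derivative of [f] does not vanish, the preimage of an
   interval of length [l] is covered by boxes of total volume [O(l)].  By the
   identity theorem, at every point some partial derivative of positive order is
   nonzero.  Descend along a chain of successive first-order derivatives from
   [f] to this one: a point where the covering bound fails for one term of the
   chain is a zero of the next term, and the zeros of the next term at which the
   bound holds for it are covered by boxes of arbitrarily small total volume,
   while the others are null by induction. *)

#[local] Existing Instance summability.totally_filter.

(** * Outer measure and null sets *)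

Lemma esum_geometric_half (R : realType) (I : countType) (D : set I) (e : R) :
  0 <= e ->
  (\esum_(i in D) (e / (2 ^ (pickle i).+1)%:R)%:E <= e%:E)%E.
Proof.
move=> e0.
have -> : (\esum_(i in D) (e / (2 ^ (pickle i).+1)%:R)%:E =
           \esum_(k in pickle @` D) (e / (2 ^ k.+1)%:R)%:E)%E.
  rewrite esum_image// => i j _ _; exact: (pcan_inj pickleK).
apply: le_trans (epsilon_trick0 xpredT e0).
rewrite nneseries_esumT; last by move=> k; rewrite lee_fin divr_ge0.
rewrite esum_mkcond; apply: le_esum => k _; case: ifP => // _.
by rewrite lee_fin divr_ge0.
Qed.

Section outer_measure.
Context {R : realType} {n : nat}.
Implicit Types (X Y : set 'rV[R]_n).
Local Notation mu := (@lebesgue_outer_measure R n).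

Lemma box_volume_ge0 (a b : 'rV[R]_n) : 0 <= box_volume a b.
Proof. by apply: prodr_ge0 => i _; rewrite le_max lexx. Qed.

Lemma outer_ge0 X : (0 <= mu X)%E.
Proof.
apply: le_ereal_inf_tmp => _ [D [a [b [_ ->]]]].
by apply: esum_ge0 => k _; rewrite lee_fin box_volume_ge0.
Qed.

Lemma outer_mono X Y : X `<=` Y -> (mu X <= mu Y)%E.
Proof.
move=> XY; apply: le_ereal_inf_tmp => _ [D [a [b [YD ->]]]].
by apply: ereal_inf_lbound; exists D, a, b; split => //; apply: subset_trans YD.
Qed.

Lemma outer_null_mono X Y : X `<=` Y -> mu Y = 0%E -> mu X = 0%E.
Proof.
by move=> XY Y0; apply/eqP; rewrite eq_le outer_ge0 andbT -Y0; exact: outer_mono.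
Qed.

(** The definition admits only families indexed by sets of natural numbers. Transport along [pickle]
    lets covers be indexed by any countable type, such as the pairs in [outer_subadditive]. *)
Lemma outer_le_cover (I : countType) (D : set I) (a b : I -> 'rV[R]_n) X :
  X `<=` \bigcup_(i in D) box (a i) (b i) ->
  (mu X <= \esum_(i in D) (box_volume (a i) (b i))%:E)%E.
Proof.
move=> XD; apply: ereal_inf_lbound.
pose a' k := if unpickle k is Some i then a i else 0.
pose b' k := if unpickle k is Some i then b i else 0.
exists (pickle @` D), a', b'; split.
  move=> x /XD [i Di xi]; exists (pickle i); first by exists i.
  by rewrite /a' /b' pickleK.
rewrite esum_image; last by move=> i j _ _; exact: (pcan_inj pickleK).
by apply: eq_esum => i Di; rewrite /a' /b' pickleK.
Qed.

Lemma outer_box_le (a b : 'rV[R]_n) : (mu (box a b) <= (box_volume a b)%:E)%E.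
Proof.
apply: (@le_trans _ _ (\esum_(i in [set tt]) (box_volume a b)%:E)%E).
  by apply: outer_le_cover => x xab; exists tt.
by rewrite esum_set1// lee_fin box_volume_ge0.
Qed.

Lemma outer_subadditive (I : countType) (D : set I) (E : I -> set 'rV[R]_n) :
  (mu (\bigcup_(i in D) E i) <= \esum_(i in D) mu (E i))%E.
Proof.
(* If some [E i] has infinite outer measure, the right-hand side is infinite. Otherwise every [E i]
   has a cover that is optimal up to a positive error. *)
have [[i [Di Eoo]]|/forallNP fin] := pselect (exists i, D i /\ mu (E i) = +oo%E).
  apply: (@le_trans _ _ +oo%E); first exact: leey.
  rewrite -Eoo (esumID [set i])/=; last by move=> *; exact: outer_ge0.
  rewrite setI1 mem_set// esum_set1 ?outer_ge0// leeDl//.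
  by apply: esum_ge0 => *; exact: outer_ge0.
apply/lee_addgt0Pr => e e0.
pose ei i := e / (2 ^ (@pickle I i).+1)%:R.
have ei0 i : 0 < ei i by rewrite divr_gt0// ltr0n expn_gt0.
(* The cover of [E i] exceeds its outer measure by at most [ei i], and these errors add up to at
   most [e]. Outside [D] the choice is a dummy. *)
have /choice[F HF] : forall i, exists F : set nat * (nat -> 'rV[R]_n) * (nat -> 'rV[R]_n),
    D i -> E i `<=` \bigcup_(k in F.1.1) box (F.1.2 k) (F.2 k) /\
      (\esum_(k in F.1.1) (box_volume (F.1.2 k) (F.2 k))%:E <= mu (E i) + (ei i)%:E)%E.
  move=> i; have [Di|nDi] := pselect (D i); last by exists (set0, fun=> 0, fun=> 0).
  have : mu (E i) \is a fin_num.
    by rewrite ge0_fin_numE ?outer_ge0// ltey; apply/eqP => h; apply: (fin i).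
  move=> /(lb_ereal_inf_adherent (ei0 i))[_ [D' [a [b [ED ->]]]] lt].
  by exists (D', a, b) => _; split => //; exact: ltW.
apply: (@le_trans _ _ (\esum_(i in D) (mu (E i) + (ei i)%:E))%E); last first.
  rewrite esumD; last 2 first.
  - by move=> *; exact: outer_ge0.
  - by move=> i _; rewrite lee_fin ltW.
  by rewrite leeD2l// esum_geometric_half// ltW.
apply: (@le_trans _ _ (\esum_(i in D) \esum_(k in (F i).1.1)
    (box_volume ((F i).1.2 k) ((F i).2 k))%:E)%E); last first.
  by apply: le_esum => i /(HF i)[].
rewrite esum_esum; last by move=> *; rewrite lee_fin box_volume_ge0.
apply: (@outer_le_cover (I * nat)%type _ (fun p => (F p.1).1.2 p.2) (fun p => (F p.1).2 p.2)).
move=> x [i Di xi]; have [/(_ _ xi)[k Dk xk] _] := HF i Di.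
by exists (i, k).
Qed.

Lemma outer_null_bigcup (I : countType) (D : set I) (E : I -> set 'rV[R]_n) :
  (forall i, D i -> mu (E i) = 0%E) -> mu (\bigcup_(i in D) E i) = 0%E.
Proof.
move=> E0; apply/eqP; rewrite eq_le outer_ge0 andbT.
by apply: le_trans (outer_subadditive _ _) _; rewrite esum1.
Qed.

Lemma outer_null_setU X Y : mu X = 0%E -> mu Y = 0%E -> mu (X `|` Y) = 0%E.
Proof.
move=> X0 Y0.
apply: (@outer_null_mono _ (\bigcup_(i in [set: bool]) if i then X else Y)).
  by move=> x [Xx|Yx]; [exists true|exists false].
by apply: outer_null_bigcup => -[].
Qed.

(* Lindelöf property: boxes with rational vertices form a countable base. *)
Lemma outer_null_local X :
  (forall x, X x -> exists2 V, nbhs x V & mu (V `&` X) = 0%E) -> mu X = 0%E.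
Proof.
move=> loc.
pose rbox (p : 'rV[rat]_n * 'rV[rat]_n) : set 'rV[R]_n :=
  box (map_mx ratr p.1) (map_mx ratr p.2).
apply: (@outer_null_mono _
  (\bigcup_(p in [set p | mu (rbox p `&` X) = 0%E]) (rbox p `&` X))); last first.
  exact: outer_null_bigcup.
move=> x Xx; have [V /nbhs_ballP[e /= e0 eV] V0] := loc x Xx.
have ap i : exists p : rat * rat, (x ord0 i - e < ratr p.1 < x ord0 i) /\
    (x ord0 i < ratr p.2 < x ord0 i + e).
  have : x ord0 i - e < x ord0 i by rewrite ltrBlDr ltrDl.
  move=> /rat_in_itvoo[p]; rewrite in_itv/= => pP.
  have : x ord0 i < x ord0 i + e by rewrite ltrDl.
  by move=> /rat_in_itvoo[q]; rewrite in_itv/= => qP; exists (p, q).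
have {ap} /choice[p pP] := ap.
have xp : rbox (\row_i (p i).1, \row_i (p i).2) x.
  move=> i; rewrite !mxE; have [/andP[_ h1] /andP[h2 _]] := pP i.
  by rewrite !ltW.
exists (\row_i (p i).1, \row_i (p i).2) => //.
apply: outer_null_mono V0 => y [yp Xy]; split => //; apply: eV; split => // i j.
rewrite (ord1 i); have := yp j; rewrite !mxE => /andP[h1 h2].
have [/andP[h3 h4] /andP[h5 h6]] := pP j.
by rewrite /ball/= ltr_norml; apply/andP; split; lra.
Qed.

End outer_measure.

(** * Preimages of intervals *)

Lemma esumZl_le (R : realType) (I : choiceType) (D : set I) (c : R)
    (a : I -> R) : 0 <= c -> (forall i, 0 <= a i) ->
  (\esum_(i in D) (c * a i)%:E <= c%:E * \esum_(i in D) (a i)%:E)%E.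
Proof.
move=> c0 a0; apply: ge_ereal_sup => _ [X [finX XD] <-].
under eq_fsbigr do rewrite EFinM.
rewrite -ge0_mule_fsumr//.
apply: lee_wpmul2l; first by rewrite lee_fin.
by apply: ereal_sup_ubound; exists X.
Qed.

Lemma esum_finType (R : realType) (I : finType) (a : I -> R) :
  (forall i, 0 <= a i) ->
  (\esum_(i in [set: I]) (a i)%:E = (\sum_i a i)%:E)%E.
Proof.
move=> a0; rewrite esum_fset; last 2 first.
- exact: finite_finset.
- by move=> i _; rewrite lee_fin.
rewrite (fsbigE _ _ (index_enum_uniq I))//; last first.
  by move=> i _; rewrite mem_index_enum.
by rewrite -sumEFin; apply: eq_bigl => i; rewrite in_setT.
Qed.

Definition cube (R : realType) (n : nat) (a : 'rV[R]_n) (r : R) : set 'rV[R]_n :=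
  [set x | forall i, `|x ord0 i - a ord0 i| <= r].

Section regular_points.
Context {R : realType} {n : nat}.
Implicit Types (g : 'rV[R]_n -> R) (V : set 'rV[R]_n).
Local Notation mu := (@lebesgue_outer_measure R n).

Lemma outer_set0 : mu set0 = 0%E.
Proof.
rewrite -(bigcup_set0 (fun _ : nat => set0)).
exact: (@outer_null_bigcup _ _ nat set0).
Qed.

Section cell_cover.
Context (j : 'I_n) (a : 'rV[R]_n) (r C : R) (g : 'rV[R]_n -> R).
Hypotheses (r0 : 0 <= r) (C0 : 0 <= C).
(** This is what a derivative along [j] bounded away from zero provides: the value of [g] determines
    the [j]-th coordinate up to an error controlled by the other coordinates. *)
Hypothesis gP : forall x y h, cube a r x -> cube a r y -> 0 <= h ->
  (forall i, i != j -> `|x ord0 i - y ord0 i| <= h) ->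
  `|x ord0 j - y ord0 j| <= C * (`|g x - g y| + h).

(* In each column of side [h <= v - u] in the coordinates other than [j], the
   points of the preimage lie at height within [C * (v - u + h)] of any one of
   them. *)
Let outer_preimage_lt (u v : R) : u < v ->
  (mu (cube a r `&` [set x | (u <= g x <= v)%R]) <=
   (4 * C * (\prod_(i < n | i != j) (2 * r)) * (v - u))%:E)%E.
Proof.
move=> uv; set l := v - u; have l0 : 0 < l by rewrite subr_gt0.
(* Cutting [2 * r] into [T.+1] parts is just enough to make the side [h] at most [l]. *)
pose T := Num.truncn (2 * r / l).
pose h := 2 * r / T.+1%:R.
have h0 : 0 <= h by rewrite divr_ge0// mulr_ge0.
have hl : h <= l.
  rewrite ler_pdivrMr ?ltr0n// [l * _]mulrC -ler_pdivrMr//.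
  by rewrite ltW// truncnS_gt.
pose w := C * (l + h).
have w0 : 0 <= w by rewrite mulr_ge0// addr_ge0// ltW.
pose lo i (t : 'I_T.+1) := a ord0 i - r + t%:R * h.
pose E (s : {ffun 'I_n -> 'I_T.+1}) := [set x | [/\ s j = ord0,
  cube a r x, u <= g x <= v &
  forall i, i != j -> lo i (s i) <= x ord0 i <= lo i (s i) + h]].
(* The columns are indexed by all functions [s], with [E s] empty unless [s j] is [ord0]. Weight 0
   at the other values of [s j] lets the total volume factor over the coordinates. *)
pose wt i (t : 'I_T.+1) : R :=
  if i == j then (if t == ord0 then 2 * w else 0) else h.
have wt0 i t : 0 <= wt i t.
  by rewrite /wt; case: ifP => // _; case: ifP => // _; rewrite mulr_ge0.
apply: (@le_trans _ _ (mu (\bigcup_(s in [set: {ffun 'I_n -> 'I_T.+1}]) E s))).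
  apply: outer_mono => x [/= xa gx].
  have xt i : exists t : 'I_T.+1, lo i t <= x ord0 i <= lo i t + h.
    have := xa i; rewrite ler_norml => /andP[x1 x2].
    pose s := x ord0 i - (a ord0 i - r).
    have s0 : 0 <= s by rewrite /s; lra.
    have s2 : s <= T.+1%:R * h by rewrite mulrC divfK ?pnatr_eq0// /s; lra.
    have xs : x ord0 i = a ord0 i - r + s by rewrite /s; lra.
    have [h00|hn0] := eqVneq h 0.
      exists ord0; rewrite /lo xs h00 mul0r !addr0.
      by move: s2; rewrite h00 mulr0; lra.
    have hgt0 : 0 < h by rewrite lt_def hn0.
    have [t1 t2] : (Num.truncn (s / h))%:R * h <= s /\ s <= (Num.truncn (s / h)).+1%:R * h.
      have sh : 0 <= s / h by rewrite divr_ge0.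
      have /andP[t1 t2] := truncn_itv sh.
      by rewrite -ler_pdivlMr// t1 -ler_pdivrMr// ltW.
    have [tT|tT] := leqP (Num.truncn (s / h)) T.
      exists (Ordinal (tT : (_ < T.+1)%N)); rewrite /lo/= xs.
      by move: t2; rewrite -natr1; lra.
    (* Only the right end [s = 2 * r] of the range gets here; it belongs to the last, closed
       part. *)
    exists ord_max; rewrite /lo/= xs; move: s2; rewrite -natr1.
    have : T.+1%:R * h <= (Num.truncn (s / h))%:R * h by rewrite ler_wpM2r// ler_nat.
    by rewrite -natr1; lra.
  have {xt} /choice[t tP] := xt.
  exists [ffun i => if i == j then ord0 else t i] => //; split => //.
    by rewrite ffunE eqxx.
  by move=> i ij; rewrite ffunE (negbTE ij).
apply: le_trans (outer_subadditive _ _) _.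
apply: (@le_trans _ _ (\esum_(s in [set: {ffun 'I_n -> 'I_T.+1}])
    (\prod_i wt i (s i))%:E)%E).
  apply: le_esum => s _.
  have [[y [sj ya gy ys]]|/forallNP E0] := pselect (exists y, E s y); last first.
    rewrite (_ : E s = set0) ?outer_set0 ?lee_fin ?prodr_ge0//.
    by apply/seteqP; split => // x /E0.
  pose p : 'rV[R]_n := \row_i if i == j then y ord0 j - w else lo i (s i).
  pose q : 'rV[R]_n := \row_i if i == j then y ord0 j + w else lo i (s i) + h.
  apply: (@le_trans _ _ (mu (box p q))).
    apply: outer_mono => x [_ xa gx xs] i; rewrite !mxE.
    case: eqVneq => [->|ij]; last exact: xs.
    rewrite -ler_distl; apply: le_trans (gP xa ya h0 _) _.
      move=> k kj; have /andP[x1 x2] := xs k kj; have /andP[y1 y2] := ys k kj.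
      by rewrite ler_norml; apply/andP; split; lra.
    rewrite ler_wpM2l// lerD2r ler_norml /l.
    by move: gx gy => /andP[? ?] /andP[? ?]; apply/andP; split; lra.
  apply: le_trans (outer_box_le _ _) _.
  rewrite lee_fin; apply: ler_prod => i _; rewrite le_max lexx/= !mxE /wt.
  case: eqVneq => [->|ij]; first by rewrite sj eqxx ge_max mulr_ge0//=; lra.
  by rewrite ge_max h0/=; lra.
rewrite esum_finType; last by move=> s; exact: prodr_ge0.
(* The sum of products is a product of sums: coordinate [j] contributes [2 * w], and each other one
   [T.+1 * h = 2 * r]. *)
rewrite lee_fin -(bigA_distr_bigA (fun i t => wt i t)).
rewrite (bigD1 j)//= {1}/wt eqxx -big_mkcond/= big_pred1_eq.
rewrite (eq_bigr (fun=> 2 * r)); last first.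
  move=> i ij; rewrite /wt (negbTE ij) sumr_const card_ord /h -[_ *+ T.+1]mulr_natr.
  by rewrite divfK// pnatr_eq0.
rewrite [leRHS](_ : _ = 2 * (C * (l + l)) * \prod_(i < n | i != j) (2 * r)).
  rewrite ler_wpM2r ?prodr_ge0//; first by move=> i _; rewrite mulr_ge0.
  by rewrite ler_wpM2l// ler_wpM2l// lerD2l.
by rewrite -/l; ring.
Qed.

(** The grid needs an interval of positive length. The case [u = v] is reached by enlarging the
    interval by [e / (K + 1)], where [K + 1] guards against [K = 0]. *)
Lemma outer_preimage_itv : exists2 K : R, 0 <= K & forall u v : R, u <= v ->
  (mu (cube a r `&` [set x | (u <= g x <= v)%R]) <= (K * (v - u))%:E)%E.
Proof.
pose K := 4 * C * (\prod_(i < n | i != j) (2 * r)).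
have K0 : 0 <= K.
  by rewrite !mulr_ge0//; apply: prodr_ge0 => i _; rewrite mulr_ge0.
exists K => // u v uv; apply/lee_addgt0Pr => e e0.
have eK : 0 < e / (K + 1) by rewrite divr_gt0// ltr_wpDl.
apply: (@le_trans _ _ (mu (cube a r `&` [set x | u <= g x <= v + e / (K + 1)]))).
  apply: outer_mono => x [xa /= /andP[ux xv]]; split => //=.
  by rewrite ux/= (le_trans xv)// lerDl ltW.
apply: le_trans (outer_preimage_lt _) _; first by rewrite ltr_pwDr.
rewrite -EFinD lee_fin -/K.
have : K * (e / (K + 1)) <= e.
  rewrite mulrCA; apply: ler_piMr; first exact: ltW.
  by rewrite ler_pdivrMr ?mul1r ?lerDl// ltr_wpDl.
lra.
Qed.

End cell_cover.

(** Near [x], the image of Lebesgue measure under [g] is at most [K] times Lebesgue measure, tested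
    on intervals only. *)
Definition regular_at g (x : 'rV[R]_n) := exists2 V, nbhs x V &
  exists2 K : R, 0 <= K & forall u v : R, u <= v ->
    (mu (V `&` [set x | (u <= g x <= v)%R]) <= (K * (v - u))%:E)%E.

(** Locally, a cover of [N] by intervals of total length below [e / (K + 1)] pulls back to sets of
    total outer measure at most [e]. *)
Lemma regular_preimage_null g (N : set R) :
  lebesgue_outer_measure [set y : 'rV[R]_1 | N (y ord0 ord0)] = 0%E ->
  mu ([set x | regular_at g x] `&` [set x | N (g x)]) = 0%E.
Proof.
move=> N0; apply: outer_null_local => x [/= [V xV [K K0 KP]] _].
exists V => //; apply: (@outer_null_mono _ _ _ (V `&` [set x | N (g x)])).
  by move=> y [Vy [_ Ny]].
apply/eqP; rewrite eq_le outer_ge0 andbT; apply/lee_addgt0Pr => e e0.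
rewrite add0e.
have eK : 0 < e / (K + 1) by rewrite divr_gt0// ltr_wpDl.
have : lebesgue_outer_measure [set y : 'rV[R]_1 | N (y ord0 ord0)] \is a fin_num.
  by rewrite N0.
move=> /(lb_ereal_inf_adherent eK)[_ [D [a [b [ND ->]]]]].
rewrite -/(lebesgue_outer_measure _) N0 add0e => vol.
apply: (@le_trans _ _ (mu (\bigcup_(k in D) (V `&`
    [set x | (a k ord0 ord0 <= g x <= b k ord0 ord0)%R])))).
  apply: outer_mono => y [Vy Ny].
  have /ND[k Dk yk] : [set y : 'rV[R]_1 | N (y ord0 ord0)] (const_mx (g y)).
    by rewrite /= mxE.
  by exists k => //; split => //; have := yk ord0; rewrite mxE.
apply: le_trans (outer_subadditive _ _) _.
apply: (@le_trans _ _ (\esum_(k in D) (K * box_volume (a k) (b k))%:E)%E).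
  apply: le_esum => k _; rewrite /box_volume big_ord1.
  have [ab|ba] := leP (a k ord0 ord0) (b k ord0 ord0).
    by rewrite max_r ?subr_ge0//; exact: KP.
  rewrite (_ : _ `&` _ = set0) ?outer_set0 ?lee_fin ?mulr_ge0 ?le_max ?lexx//.
  apply/seteqP; split => // y [_ /= /andP[h1 h2]].
  by have := le_trans h1 h2; rewrite leNgt ba.
apply: le_trans (esumZl_le _ K0 _) _; first by move=> k; exact: box_volume_ge0.
apply: (@le_trans _ _ (K%:E * (e / (K + 1))%:E)%E).
  by rewrite lee_wpmul2l ?lee_fin// ltW.
rewrite -EFinM lee_fin.
rewrite mulrCA; apply: ler_piMr; first exact: ltW.
by rewrite ler_pdivrMr ?mul1r ?lerDl// ltr_wpDl.
Qed.

End regular_points.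

(** * Unordered sums *)

Section unordered_sums.
Import finmap.
Context {R : realType} {I : choiceType}.
Implicit Types (x : I -> R) (A B : {fset I}).

Lemma partial_sumE x A : summability.partial_sum x A = \sum_(i <- A) x i.
Proof. by rewrite /summability.partial_sum (big_seq_fsetE _ _ predT). Qed.

Lemma fset_sum_split x A B : (A `<=` B)%fset ->
  \sum_(i <- B) x i = \sum_(i <- A) x i + \sum_(i <- (B `\` A)%fset) x i.
Proof.
move=> AB; rewrite (big_fsetID _ (mem A))/=; congr (_ + _).
  apply: eq_fbigl => i; rewrite !inE/=.
  by apply/andP/idP => [[]//|iA]; rewrite iA (fsubsetP AB).
by apply: eq_fbigl => i; rewrite !inE/= andbC.
Qed.

(** Cauchy criterion: once the absolute sum over [A] is within [e] of the supremum, adding further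
    indices changes the sum by less than [e]. *)
Lemma abs_bounded_cvg x (M : R) :
  (forall A, \sum_(i <- A) `|x i| <= M) ->
  cvg (summability.partial_sum x @ summability.totally).
Proof.
move=> xM; apply: cauchy_cvg; apply: cauchy_exP => e e0.
pose S := [set \sum_(i <- A) `|x i| | A in [set: {fset I}]].
have Ssup : has_sup S.
  split; first by exists (\sum_(i <- fset0) `|x i|); exists fset0.
  by exists M => _ [A _ <-].
have [_ [A _ <-] As] := sup_adherent e0 Ssup.
exists (summability.partial_sum x A); exists A => // B /= AB.
rewrite /ball/= !partial_sumE (fset_sum_split _ AB) opprD addNKr normrN.
apply: le_lt_trans (ler_norm_sum _ _ _) _.
have : \sum_(i <- B) `|x i| <= sup S by apply: ub_le_sup; [case: Ssup|exists B].
by rewrite (fset_sum_split _ AB); lra.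
Qed.

(** Finite sums over sets disjoint from a suitable [A0] are at most 2 in absolute value. Applied to
    the nonnegative and to the negative terms separately, this bounds the absolute sums off [A0] by
    4. *)
Lemma cvg_abs_bounded x (l : R) :
  summability.partial_sum x @ summability.totally --> l ->
  exists M : R, forall A, \sum_(i <- A) `|x i| <= M.
Proof.
move=> /cvgrPdist_lt/(_ _ ltr01)[A0 _ A0P].
have tail B : [disjoint A0 & B]%fset -> `|\sum_(i <- B) x i| <= 2.
  move=> dB; have := A0P A0 (fsubset_refl _); have := A0P _ (fsubsetUl A0 B).
  rewrite /= !partial_sumE (fset_sum_split _ (fsubsetUl A0 B)).
  rewrite (_ : ((A0 `|` B) `\` A0)%fset = B); last first.
    rewrite fsetDUl fsetDv fset0U; apply/eqP.
    by rewrite eqEfsubset fsubsetDl fsubsetD fsubset_refl fdisjoint_sym.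
  set s := \sum_(i <- A0) x i; set t := \sum_(i <- B) x i => h1 h2.
  rewrite (_ : t = (l - s) - (l - (s + t))); last by ring.
  by apply: le_trans (ler_normB _ _) _; lra.
exists (\sum_(i <- A0) `|x i| + 4) => A.
have /le_trans -> // : \sum_(i <- A) `|x i| <= \sum_(i <- (A0 `|` A)%fset) `|x i|.
  by rewrite (fset_sum_split _ (fsubsetUr A0 A)) lerDl sumr_ge0.
rewrite (fset_sum_split _ (fsubsetUl A0 A)) lerD2l.
set B := (_ `\` _)%fset.
rewrite (big_fsetID _ (fun i => 0 <= x i))/=.
set Bp := [fset i in B | 0 <= x i]%fset.
set Bn := [fset i in B | ~~ (0 <= x i)]%fset.
have dB i : i \in A0 -> i \notin B by move=> iA; rewrite !inE iA.
have hp : \sum_(i <- Bp) `|x i| <= 2.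
  rewrite (_ : \sum_(i <- Bp) _ = \sum_(i <- Bp) x i); last first.
    by apply: eq_fbigr => i; rewrite !inE/= => /andP[_ /ger0_norm].
  apply: le_trans (ler_norm _) (tail _ _).
  apply/fdisjointP => i /dB; apply: contra.
  by rewrite in_fset/= => /andP[].
have hn : \sum_(i <- Bn) `|x i| <= 2.
  rewrite (_ : \sum_(i <- Bn) _ = - \sum_(i <- Bn) x i); last first.
    rewrite -sumrN; apply: eq_fbigr => i; rewrite !inE/= -ltNge => /andP[_ x0].
    by rewrite ltr0_norm.
  apply: le_trans (ler_norm _) _; rewrite normrN; apply: tail.
  apply/fdisjointP => i /dB; apply: contra.
  by rewrite in_fset/= => /andP[].
lra.
Qed.

End unordered_sums.

(** * Derivatives of monomials *)

Definition bump_index n (j : 'I_n) (al : {ffun 'I_n -> nat}) : {ffun 'I_n -> nat} :=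
  [ffun i => (al i + (i == j))%N].

Section monomials.
Context {R : realType}.
Implicit Types (r s z : R).

Lemma bin_le_exp2 m k : ('C(m, k) <= 2 ^ m)%N.
Proof.
elim: m k => [|m IH] [|k] //=; first by rewrite bin0 expn_gt0.
by rewrite binS expnS mul2n -addnn leq_add.
Qed.

(* The [k]-th derivative of [s ^+ m]. *)
Definition dmonomial (k m : nat) s : R := (m ^_ k)%:R * s ^+ (m - k).

Lemma norm_dmonomial_le r s k m : `|s| <= r ->
  `|dmonomial k m s| <= dmonomial k m r.
Proof.
move=> sr; rewrite /dmonomial normrM normr_nat ler_wpM2l// normrX.
by apply: lerXn2r; rewrite ?nnegrE// (le_trans _ sr).
Qed.

(** The falling factorial is [k!] times a binomial coefficient, which is at most [2 ^ m]. Hence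
    derivatives at radius [r] are dominated by monomials at radius [2 * r], with a factor
    independent of [m]. *)
Lemma dmonomial_le r k m : 0 < r ->
  dmonomial k m r <= (k`!%:R * r^-1 ^+ k) * (2 * r) ^+ m.
Proof.
move=> r0; have r0' := ltW r0; rewrite /dmonomial; have [km|mk] := leqP k m; last first.
  by rewrite ffact_small// mul0r !(mulr_ge0, exprn_ge0)// invr_ge0.
rewrite -bin_ffact natrM exprB ?unitfE ?gt_eqF// exprMn exprVn.
rewrite [leRHS](_ : _ = 2 ^+ m * k`!%:R * (r ^+ m / r ^+ k)); last by ring.
rewrite ler_wpM2r ?divr_ge0 ?exprn_ge0//.
by rewrite ler_wpM2r// -natrX ler_nat bin_le_exp2.
Qed.

(** Induction on [k]: the remainder for [k.+1] is [z] times the remainder for [k] plus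
    [(z - s) ^+ 2 * (k%:R * s ^+ k.-1)]. *)
Lemma exp_taylor1 r s z k : `|s| <= r -> `|z| <= r ->
  `|z ^+ k - s ^+ k - (z - s) * (k%:R * s ^+ k.-1)| <=
    (z - s) ^+ 2 * (k%:R * k.-1%:R * r ^+ k.-2).
Proof.
move=> sr zr; have r0 : 0 <= r by exact: le_trans (normr_ge0 _) sr.
elim: k => [|k IH]; first by rewrite !mul0r !mulr0 !expr0 subrr subr0 normr0.
set E := z ^+ k - s ^+ k - _ in IH.
have -> : z ^+ k.+1 - s ^+ k.+1 - (z - s) * (k.+1%:R * s ^+ k.+1.-1) =
    z * E + (z - s) ^+ 2 * (k%:R * s ^+ k.-1).
  rewrite /E; case: k {IH E} => [|k]; first by rewrite !expr0 expr1; ring.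
  by rewrite /= -!natr1 !exprS; ring.
apply: le_trans (ler_normD _ _) _; rewrite normrM.
have h1 : `|z| * `|E| <= r * ((z - s) ^+ 2 * (k%:R * k.-1%:R * r ^+ k.-2)).
  by apply: ler_pM.
have h2 : `|(z - s) ^+ 2 * (k%:R * s ^+ k.-1)| <= (z - s) ^+ 2 * (k%:R * r ^+ k.-1).
  rewrite normrM ger0_norm ?sqr_ge0// ler_wpM2l ?sqr_ge0// normrM normr_nat.
  rewrite ler_wpM2l// normrX.
  by apply: lerXn2r; rewrite ?nnegrE.
apply: le_trans (lerD h1 h2) _.
case: k {IH E h1 h2} => [|[|k]]; rewrite /=.
- by rewrite !(mul0r, mulr0) addr0.
- rewrite !(mulr0, mul0r) add0r expr0 !mulr1.
  by apply: ler_peMr; rewrite ?sqr_ge0// ler1n.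
rewrite [X in X + _ <= _](_ : _ = (z - s) ^+ 2 * (k.+2%:R * k.+1%:R * r ^+ k.+1)); last first.
  by rewrite [r ^+ k.+1]exprS; ring.
rewrite -mulrDr ler_wpM2l ?sqr_ge0// -mulrDl ler_wpM2r ?exprn_ge0//.
by rewrite -!natrM -natrD ler_nat addnC -mulnS leq_mul.
Qed.

Lemma dmonomial_taylor1 r s z k m : `|s| <= r -> `|z| <= r ->
  `|dmonomial k m z - dmonomial k m s - (z - s) * dmonomial k.+1 m s| <=
    (z - s) ^+ 2 * dmonomial k.+2 m r.
Proof.
move=> sr zr; rewrite /dmonomial !ffactnSr !subnS !natrM.
rewrite (_ : _ - _ = (m ^_ k)%:R * (z ^+ (m - k) - s ^+ (m - k) -
  (z - s) * ((m - k)%:R * s ^+ (m - k).-1))); last by ring.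
rewrite [leRHS](_ : _ = (m ^_ k)%:R * ((z - s) ^+ 2 *
  ((m - k)%:R * (m - k).-1%:R * r ^+ (m - k).-2))); last by ring.
by rewrite normrM normr_nat ler_wpM2l// exp_taylor1.
Qed.

End monomials.

Section multivariate_monomials.
Context {R : realType} {n : nat}.
Implicit Types (al m : {ffun 'I_n -> nat}) (w z : 'rV[R]_n) (r : R).

Definition dmonomialn al m w : R := \prod_i dmonomial (al i) (m i) (w ord0 i).

(** The part of the bound in [dmonomial_le] that does not involve the exponent, multiplied over the
    coordinates. *)
Definition dmonomial_const r al : R := \prod_i ((al i)`!%:R * r^-1 ^+ al i).

Lemma dmonomial_const_ge0 r al : 0 < r -> 0 <= dmonomial_const r al.
Proof.
by move=> r0; apply: prodr_ge0 => i _; rewrite mulr_ge0// exprn_ge0// invr_ge0 ltW.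
Qed.

Lemma norm_dmonomialn_le r al m w : 0 < r -> (forall i, `|w ord0 i| <= r) ->
  `|dmonomialn al m w| <= dmonomial_const r al * \prod_i (2 * r) ^+ m i.
Proof.
move=> r0 wr; rewrite normr_prod -big_split/=; apply: ler_prod => i _.
rewrite normr_ge0/=; apply: le_trans (norm_dmonomial_le _ _ (wr i)) _.
exact: dmonomial_le.
Qed.

(** Since only coordinate [j] moves, the factors at the other coordinates form a common factor [P],
    and the one-variable estimate applies to the remaining factor. *)
Lemma dmonomialn_taylor1 r al m (j : 'I_n) w z : 0 < r ->
  (forall i, `|w ord0 i| <= r) -> (forall i, `|z ord0 i| <= r) ->
  (forall i, i != j -> z ord0 i = w ord0 i) ->
  `|dmonomialn al m z - dmonomialn al m w -
    (z ord0 j - w ord0 j) * dmonomialn (bump_index j al) m w| <=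
  (z ord0 j - w ord0 j) ^+ 2 *
    (dmonomial_const r (bump_index j (bump_index j al)) * \prod_i (2 * r) ^+ m i).
Proof.
move=> r0 wr zr zw; 
have prodD1 (F : 'I_n -> R) : \prod_i F i = F j * \prod_(i < n | i != j) F i.
  by rewrite (bigD1 j).
rewrite /dmonomialn /dmonomial_const.
rewrite (prodD1 (fun i => dmonomial (al i) (m i) (z ord0 i))).
rewrite (prodD1 (fun i => dmonomial (al i) (m i) (w ord0 i))).
rewrite (prodD1 (fun i => dmonomial (bump_index j al i) (m i) (w ord0 i))).
rewrite (prodD1 (fun i => (2 * r) ^+ m i)).
rewrite (prodD1 (fun i => _%:R * _)).
set P := \prod_(i < n | i != j) dmonomial (al i) (m i) (w ord0 i).
rewrite (_ : \prod_(i < n | i != j) dmonomial (al i) (m i) (z ord0 i) = P); last first.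
  by apply: eq_bigr => i /zw ->.
rewrite (_ : \prod_(i < n | i != j) dmonomial (bump_index j al i) _ _ = P); last first.
  by apply: eq_bigr => i ij; rewrite ffunE (negbTE ij) addn0.
rewrite {1}/bump_index ffunE eqxx addn1.
rewrite (_ : _ - _ = (dmonomial (al j) (m j) (z ord0 j) -
  dmonomial (al j) (m j) (w ord0 j) -
  (z ord0 j - w ord0 j) * dmonomial (al j).+1 (m j) (w ord0 j)) * P); last by ring.
rewrite normrM [X in _ <= _ ^+ 2 * X]mulrACA [leRHS]mulrA.
apply: ler_pM => //.
  apply: le_trans (dmonomial_taylor1 _ _ (wr j) (zr j)) _.
  rewrite ler_wpM2l ?sqr_ge0// !ffunE eqxx !addn1.
  exact: dmonomial_le.
rewrite normr_prod -big_split/=; apply: ler_prod => i ij.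
rewrite normr_ge0 !ffunE (negbTE ij) !addn0/=.
by apply: le_trans (norm_dmonomial_le _ _ (wr i)) _; exact: dmonomial_le.
Qed.

End multivariate_monomials.

(** * Derivatives of a power series *)

(* [F al] plays the role of the partial derivative of order [al]; only a
   first-order Taylor estimate along each coordinate is recorded. *)
Definition derivative_tower (R : realType) (n : nat) (a : 'rV[R]_n) (r : R)
    (F : {ffun 'I_n -> nat} -> 'rV[R]_n -> R) :=
  forall al, exists K : R, [/\ 0 <= K,
    forall x, cube a r x -> `|F al x| <= K &
    forall j x y, cube a r x -> cube a r y ->
      (forall i, i != j -> y ord0 i = x ord0 i) ->
      `|F al y - F al x - (y ord0 j - x ord0 j) * F (bump_index j al) x| <=
        K * (y ord0 j - x ord0 j) ^+ 2].

Section limits_of_sums.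
Context {R : realType} {I : choiceType}.
Local Notation "x ~~> l" := (summability.partial_sum x @ summability.totally --> l)
  (at level 70).

Lemma partial_sum_lim_norm_le (x : I -> R) (l B : R) : x ~~> l ->
  (forall A, `|\sum_(i <- finmap.enum_fset A) x i| <= B) -> `|l| <= B.
Proof.
move=> xl xB; rewrite leNgt; apply/negP => lB.
have FF := @summability.totally_filter I.
have e0 : 0 < `|l| - B by rewrite subr_gt0.
move/cvgrPdist_lt: xl => /(_ _ e0)[A _ /(_ A (finmap.fsubset_refl A))/=].
rewrite partial_sumE => h; have := xB A; have := lerB_dist l (\sum_(i <- finmap.enum_fset A) x i).
lra.
Qed.

Lemma partial_sum_cvg_combination (x y z : I -> R) (lx ly lz t : R) :
  x ~~> lx -> y ~~> ly -> z ~~> lz ->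
  (fun i => x i - y i - t * z i) ~~> lx - ly - t * lz.
Proof.
move=> hx hy hz; have FF := @summability.totally_filter I.
rewrite (_ : summability.partial_sum _ = (fun A => summability.partial_sum x A -
    summability.partial_sum y A - t * summability.partial_sum z A)).
  by apply: cvgB; [exact: cvgB|exact: cvgMl_tmp].
by apply/funext => A; rewrite !partial_sumE !sumrB mulr_sumr.
Qed.

End limits_of_sums.

Section power_series.
Context {R : realType} {n : nat}.
Context (a : 'rV[R]_n) (c : {ffun 'I_n -> nat} -> R) (r M : R).
Hypothesis r0 : 0 < r.
(** Absolute convergence at radius [2 * r]; it controls the termwise derivatives of every order on
    the cube of radius [r]. *)
Hypothesis cM : forall A : finmap.finset_of (Phant {ffun 'I_n -> nat}),
  \sum_(m <- finmap.enum_fset A) `|c m * \prod_i (2 * r) ^+ m i| <= M.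
Implicit Types (x y : 'rV[R]_n) (al m : {ffun 'I_n -> nat}).

Definition dterm al x m : R := c m * dmonomialn al m (x - a).

Definition dseries al x : R :=
  lim (summability.partial_sum (dterm al x) @ summability.totally).

Lemma majorant_ge0 : 0 <= M.
Proof. by have := cM finmap.fset0; rewrite finmap.big_seq_fset0. Qed.

Lemma sum_dominated_le (t : {ffun 'I_n -> nat} -> R) (K : R) : 0 <= K ->
  (forall m, `|t m| <= K * `|c m * \prod_i (2 * r) ^+ m i|) ->
  forall A : finmap.finset_of (Phant {ffun 'I_n -> nat}),
    \sum_(m <- finmap.enum_fset A) `|t m| <= K * M.
Proof.
move=> K0 tK A.
apply: (@le_trans _ _ (\sum_(m <- finmap.enum_fset A)
    (K * `|c m * \prod_i (2 * r) ^+ m i|))); first exact: ler_sum.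
by rewrite -mulr_sumr ler_wpM2l.
Qed.

Lemma majorant_norm m : `|c m * \prod_i (2 * r) ^+ m i| = `|c m| * \prod_i (2 * r) ^+ m i.
Proof.
rewrite normrM; congr (_ * _); apply: ger0_norm.
by apply: prodr_ge0 => i _; rewrite exprn_ge0// mulr_ge0// ltW.
Qed.

Lemma cube_sub x : cube a r x -> forall i, `|(x - a) ord0 i| <= r.
Proof. by move=> xa i; rewrite !mxE; exact: xa. Qed.

Lemma norm_dterm_le al x m : cube a r x ->
  `|dterm al x m| <= dmonomial_const r al * `|c m * \prod_i (2 * r) ^+ m i|.
Proof.
move=> /cube_sub xa; rewrite majorant_norm normrM mulrCA ler_wpM2l//.
exact: norm_dmonomialn_le.
Qed.

Lemma dseries_cvg al x : cube a r x ->
  summability.partial_sum (dterm al x) @ summability.totally --> dseries al x.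
Proof.
move=> xa; apply: (@abs_bounded_cvg _ _ _ (dmonomial_const r al * M)).
by apply: sum_dominated_le => [|m]; [exact: dmonomial_const_ge0|exact: norm_dterm_le].
Qed.

(** Both estimates hold term by term, with a factor independent of [m] in front of the majorant, so
    they survive summation and the limit. Summing [K2] over all [j] gives one constant for all
    directions. *)
Lemma dseries_tower : derivative_tower a r dseries.
Proof.
move=> al; pose K1 := dmonomial_const r al.
pose K2 j := dmonomial_const r (bump_index j (bump_index j al)).
have K10 : 0 <= K1 by exact: dmonomial_const_ge0.
have K20 j : 0 <= K2 j by exact: dmonomial_const_ge0.
have S0 : 0 <= \sum_j K2 j by exact: sumr_ge0.
exists ((K1 + \sum_j K2 j) * M); split.
- by rewrite mulr_ge0 ?majorant_ge0// addr_ge0.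
- move=> x xa; apply: partial_sum_lim_norm_le (dseries_cvg xa) _ => A.
  apply: le_trans (ler_norm_sum _ _ _) _.
  apply: sum_dominated_le => [|m]; first exact: addr_ge0.
  by apply: le_trans (norm_dterm_le _ _ xa) _; rewrite ler_wpM2r// lerDl.
move=> j x y xa ya yx.
apply: partial_sum_lim_norm_le
  (@partial_sum_cvg_combination _ _ _ _ _ _ _ _ (y ord0 j - x ord0 j)
    (dseries_cvg ya) (dseries_cvg xa) (dseries_cvg xa)) _.
move=> A; apply: le_trans (ler_norm_sum _ _ _) _.
rewrite mulrAC; set t := y ord0 j - x ord0 j.
apply: sum_dominated_le => [|m]; first by rewrite mulr_ge0 ?sqr_ge0// addr_ge0.
rewrite majorant_norm /dterm.
rewrite (_ : _ - _ = c m * (dmonomialn al m (y - a) - dmonomialn al m (x - a) -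
  t * dmonomialn (bump_index j al) m (x - a))); last by ring.
rewrite normrM mulrCA ler_wpM2l//.
have := @dmonomialn_taylor1 _ _ r al m j (x - a) (y - a) r0 (cube_sub xa) (cube_sub ya).
have -> : (y - a) ord0 j - (x - a) ord0 j = t by rewrite !mxE /t; ring.
move=> /(_ _)/le_trans -> //.
  by move=> i ij; rewrite !mxE yx.
rewrite [_ * t ^+ 2]mulrC -[leRHS]mulrA ler_wpM2l ?sqr_ge0// ler_wpM2r//.
  by apply: prodr_ge0 => i _; rewrite exprn_ge0// mulr_ge0// ltW.
apply: (@le_trans _ _ (\sum_j K2 j)); last by rewrite lerDr.
by rewrite (bigD1 j)//= lerDl sumr_ge0.
Qed.

(** Only the term [m = al] survives at the centre: a smaller exponent kills the falling factorial, a
    larger one leaves a positive power of 0. *)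
Lemma dseries_center al : dseries al a = c al * \prod_i (al i)`!%:R.
Proof.
have ca : cube a r a by move=> i; rewrite subrr normr0 ltW.
have FF := @summability.totally_filter {ffun 'I_n -> nat}.
apply: cvg_lim => //; apply: cvg_near_cst; exists (finmap.fset1 al) => // A /= alA.
rewrite partial_sumE (finmap.big_fsetD1 al)/=; last first.
  by rewrite (finmap.fsubsetP alA)// finmap.fset11.
rewrite big1_seq ?addr0.
  rewrite /dterm /dmonomialn; congr (_ * _); apply: eq_bigr => i _.
  by rewrite /dmonomial ffactnn subnn expr0 mulr1.
move=> m /andP[_]; rewrite finmap.in_fsetD1 => /andP[mal _].
have /existsP[i mi] : [exists i, m i != al i].
  apply: contraNT mal => /existsPn mal; apply/eqP/ffunP => i.
  by apply/eqP; rewrite -[_ == _]negbK.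
rewrite /dterm /dmonomialn (bigD1 i)//= subrr mxE /dmonomial.
have [lt|gt|e] := ltngtP (m i) (al i).
- by rewrite ffact_small// !mul0r mulr0.
- by rewrite expr0n subn_eq0 leqNgt gt mulr0 mul0r mulr0.
- by rewrite e eqxx in mi.
Qed.

End power_series.

(** * Regular points *)

Lemma nbhs_cube (R : realType) (n : nat) (a : 'rV[R]_n) (r : R) : 0 < r ->
  nbhs a (cube a r).
Proof.
move=> r0; apply/nbhs_ballP; exists r => //= x [_ ax] i.
by have := ax ord0 i; rewrite /ball/= distrC => /ltW.
Qed.

Lemma cube_center (R : realType) (n : nat) (a : 'rV[R]_n) (r : R) : 0 <= r ->
  cube a r a.
Proof. by move=> r0 i; rewrite subrr normr0. Qed.

Lemma nbhs_cubeP (R : realType) (n : nat) (a : 'rV[R]_n) (V : set 'rV[R]_n) :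
  nbhs a V -> exists2 r : R, 0 < r & cube a r `<=` V.
Proof.
move=> /nbhs_ballP[e /= e0 eV]; exists (e / 2); first by rewrite divr_gt0.
move=> x xa; apply: eV; split => // i j; rewrite (ord1 i) /ball/= distrC.
by apply: le_lt_trans (xa j) _; rewrite ltr_pdivrMr// ltr_pMr// ltr1n.
Qed.

(** Go from [x] to [y] one coordinate at a time; the intermediate points [z k] stay in the cube. *)
Lemma coordinatewise_lipschitz (R : realType) (n : nat) (a : 'rV[R]_n)
    (r L : R) (g : 'rV[R]_n -> R) :
  (forall i x y, cube a r x -> cube a r y ->
    (forall l, l != i -> y ord0 l = x ord0 l) ->
    `|g x - g y| <= L * `|x ord0 i - y ord0 i|) ->
  forall x y, cube a r x -> cube a r y ->
    `|g x - g y| <= L * \sum_i `|x ord0 i - y ord0 i|.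
Proof.
move=> gL x y xa ya.
pose z k : 'rV[R]_n := \row_(i < n) if (i < k)%N then y ord0 i else x ord0 i.
have za k : cube a r (z k) by move=> i; rewrite mxE; case: ifP.
have step k : (k <= n)%N ->
    `|g x - g (z k)| <= L * \sum_(i < n | (i < k)%N) `|x ord0 i - y ord0 i|.
  elim: k => [_|k IH kn].
    rewrite big_pred0// mulr0 (_ : z 0%N = x) ?subrr ?normr0//.
    by apply/rowP => i; rewrite mxE.
  rewrite (bigD1 (Ordinal kn))//= mulrDr [leRHS]addrC.
  rewrite (eq_bigl (fun i : 'I_n => (i < k)%N)); last first.
    by move=> i; rewrite ltnS -val_eqE/= ltn_neqAle andbC.
  apply: le_trans (ler_distD (g (z k)) _ _) _; apply: lerD; first exact/IH/ltnW.
  apply: le_trans (gL (Ordinal kn) (z k) (z k.+1) (za k) (za k.+1) _) _.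
    move=> l lk; rewrite !mxE ltnS leq_eqVlt.
    by rewrite (negbTE (_ : (l : nat) != k)).
  by rewrite !mxE/= ltnn ltnSn.
have := step n (leqnn n); rewrite (_ : z n = y); last first.
  by apply/rowP => i; rewrite mxE ltn_ord.
by rewrite (eq_bigl xpredT) => [//|i]; rewrite ltn_ord.
Qed.

Section tower.
Context {R : realType} {n : nat} (a : 'rV[R]_n) (r : R).
Context (F : {ffun 'I_n -> nat} -> 'rV[R]_n -> R).
Hypothesis r0 : 0 < r.
Hypothesis towerF : derivative_tower a r F.
Local Notation mu := (@lebesgue_outer_measure R n).

(** The Taylor estimate along [j] bounds the increment by the first derivative times [|t|] plus
    [K * t ^+ 2], and [|t| <= 2 * r] in the cube. *)
Lemma tower_lipschitz al : exists2 L : R, 0 <= L &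
  forall x y, cube a r x -> cube a r y ->
    `|F al x - F al y| <= L * \sum_i `|x ord0 i - y ord0 i|.
Proof.
have [K [K0 _ KF]] := towerF al.
have /choice[B BF] : forall j, exists B : R, 0 <= B /\
    forall x, cube a r x -> `|F (bump_index j al) x| <= B.
  by move=> j; have [B [B0 BF _]] := towerF (bump_index j al); exists B.
have B0 j : 0 <= B j by have [] := BF j.
have S0 : 0 <= \sum_j B j by exact: sumr_ge0.
exists (\sum_j B j + K * (2 * r)).
  by rewrite addr_ge0// !mulr_ge0// ltW.
apply: coordinatewise_lipschitz => j x y xa ya yx.
have := KF j x y xa ya yx.
rewrite (distrC (F al x)) (distrC (x ord0 j)).
set t := y ord0 j - x ord0 j; set G := F (bump_index j al) x.
have Gt : `|t * G| <= `|t| * \sum_j B j.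
  rewrite normrM ler_wpM2l//; have [_ /(_ x xa)/le_trans] := BF j; apply.
  by rewrite (bigD1 j)//= lerDl sumr_ge0.
have t2 : K * t ^+ 2 <= `|t| * (K * (2 * r)).
  rewrite -[t ^+ 2]real_normK ?num_real// expr2 mulrCA ler_wpM2l//.
  rewrite ler_wpM2l//; have := xa j; have := ya j; rewrite /t.
  have := ler_distD (a ord0 j) (y ord0 j) (x ord0 j).
  by rewrite (distrC (a ord0 j)); lra.
move=> taylor; rewrite [leRHS]mulrC mulrDr.
have := lerB_dist (F al y - F al x) (t * G); lra.
Qed.

(** Near [p] the derivative [G] along [j] is at least [c] in absolute value and outweighs the
    quadratic error. So a move by [t] along [j] changes [F al] by at least [|t| * (c / 2)], while
    moves in the other coordinates cost at most a Lipschitz term. This yields the hypothesis of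
    [outer_preimage_itv]. *)
Lemma tower_regular al j p : cube a (r / 2) p -> F (bump_index j al) p != 0 ->
  regular_at (F al) p.
Proof.
move=> pa Fp; have [K [K0 _ KF]] := towerF al.
have [L L0 LF] := tower_lipschitz al.
have [L' L'0 L'F] := tower_lipschitz (bump_index j al).
set G := F (bump_index j al) in Fp KF L'F.
pose c := `|G p| / 2; have c0 : 0 < c by rewrite divr_gt0// normr_gt0.
have D0 : 0 < L' * n%:R + 4 * K + 1.
  by rewrite ltr_wpDl// addr_ge0// mulr_ge0.
(* The bound [r / 2] keeps the small cube inside the given one. In the other bound, [L' * n%:R]
   keeps [|G|] above [c], and [4 * K] makes [K * t ^+ 2] at most [|t| * (c / 2)] for
   [|t| <= 2 * e]. *)
pose e := Num.min (r / 2) (c / (L' * n%:R + 4 * K + 1)).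
have e0 : 0 < e by rewrite lt_min; apply/andP; split; exact: divr_gt0.
have er : e <= r / 2 by rewrite ge_min lexx.
have ec : e * (L' * n%:R + 4 * K + 1) <= c.
  by rewrite -ler_pdivlMr// ge_min lexx orbT.
have Ke0 : 0 <= K * e by rewrite mulr_ge0// ltW.
have Le0 : 0 <= L' * n%:R * e by rewrite !mulr_ge0// ltW.
have sub x : cube p e x -> cube a r x.
  move=> xp i; have := xp i; have := pa i.
  have := ler_distD (p ord0 i) (x ord0 i) (a ord0 i); lra.
have sum_le (x y : 'rV[R]_n) (h : R) : (forall i, `|x ord0 i - y ord0 i| <= h) ->
    \sum_i `|x ord0 i - y ord0 i| <= n%:R * h.
  move=> xyh; apply: le_trans (ler_sum _ (fun i _ => xyh i)) _.
  by rewrite sumr_const card_ord -[_ *+ n]mulr_natl.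
have Gc x : cube p e x -> c <= `|G x|.
  move=> xp; have := L'F p x (sub _ (cube_center _ (ltW e0))) (sub _ xp).
  have h : \sum_i `|p ord0 i - x ord0 i| <= n%:R * e.
    by apply: sum_le => i; rewrite distrC; exact: xp.
  have := ler_wpM2l L'0 h; have := lerB_dist (G p) (G x).
  rewrite mulrA; have : `|G p| = 2 * c by rewrite /c; field.
  lra.
exists (cube p e); first exact: nbhs_cube.
apply: (@outer_preimage_itv _ _ j p e (2 / c * (1 + L * n%:R))).
- exact: ltW.
- by rewrite mulr_ge0 ?divr_ge0 ?addr_ge0 ?mulr_ge0//; exact: ltW.
move=> x y h xp yp h0 xyh.
(* The point [x'] differs from [x] only in coordinate [j] and agrees with [y] there, which separates
   the two kinds of moves. *)
pose x' : 'rV[R]_n := \row_i if i == j then y ord0 j else x ord0 i.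
have x'p : cube p e x' by move=> i; rewrite mxE; case: eqP => [->|].
have x'x i : i != j -> x' ord0 i = x ord0 i by move=> /negbTE ij; rewrite mxE ij.
have x'j : x' ord0 j = y ord0 j by rewrite mxE eqxx.
have := KF j x x' (sub _ xp) (sub _ x'p) x'x; rewrite x'j.
set t := y ord0 j - x ord0 j => taylor.
have te : `|t| <= 2 * e.
  have := ler_distD (p ord0 j) (y ord0 j) (x ord0 j).
  by have := xp j; have := yp j; rewrite (distrC (p ord0 j)) /t; lra.
have t2 : K * t ^+ 2 <= `|t| * (c / 2).
  rewrite -[t ^+ 2]real_normK ?num_real// expr2 mulrCA ler_wpM2l//.
  by have := ler_wpM2l K0 te; lra.
have tG : `|t| * c <= `|t * G x| by rewrite normrM ler_wpM2l// Gc.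
have low : `|t| * (c / 2) <= `|F al x' - F al x|.
  have := lerB_dist (t * G x) (F al x' - F al x); rewrite distrC; lra.
have up : `|F al x' - F al y| <= L * (n%:R * h).
  apply: le_trans (LF _ _ (sub _ x'p) (sub _ yp)) _; rewrite ler_wpM2l//.
  apply: sum_le => i; have [->|ij] := eqVneq i j.
    by rewrite x'j subrr normr0.
  by rewrite x'x// xyh.
have tri := ler_distD (F al y) (F al x') (F al x).
have Lh : 0 <= L * n%:R * `|F al x - F al y| by rewrite !mulr_ge0.
rewrite (distrC (x ord0 j)) -/t.
rewrite (_ : 2 / c * _ * _ = 2 * ((1 + L * n%:R) * (`|F al x - F al y| + h)) / c);
  last by ring.
rewrite ler_pdivlMr//.
rewrite (distrC (F al y)) in tri; lra.
Qed.

End tower.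

(** * Preimages of null sets under analytic functions *)

(** The tower consists of the termwise derivatives of the power series at [a]. If those of positive
    order vanish at [a], so do all nonconstant coefficients, and the series reduces to its constant
    term. *)
Lemma analytic_tower (R : realType) (n : nat) (U : set 'rV[R]_n)
    (f : 'rV[R]_n -> R) (a : 'rV[R]_n) : real_analytic_on U f -> U a ->
  exists r F, [/\ 0 < r, derivative_tower a r F,
    forall x, cube a r x -> F [ffun=> 0%N] x = f x &
    (forall al, al != [ffun=> 0%N] -> F al a = 0) ->
      forall x, cube a r x -> f x = f a].
Proof.
move=> fU /fU[c /nbhs_cubeP[e e0 eP]].
pose r := e / 2; have r0 : 0 < r by rewrite divr_gt0.
have er : 2 * r = e by rewrite /r; field.
(* Convergence at this corner of the cube is absolute, hence gives the majorant at radius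
   [2 * r = e]. *)
have /eP/= : cube a e (a + const_mx e).
  by move=> i; rewrite !mxE addrAC subrr add0r ger0_norm// ltW.
rewrite (_ : (fun k => _) = (fun k => c k * \prod_i (2 * r) ^+ k i)); last first.
  apply/funext => k; congr (_ * _); apply: eq_bigr => i _.
  by rewrite !mxE addrAC subrr add0r er.
move=> /cvg_abs_bounded[M cM].
have cr x : cube a r x -> cube a e x.
  by move=> xa i; apply: le_trans (xa i) _; rewrite -er; lra.
have term0 x : dterm a c [ffun=> 0%N] x =
    (fun k => c k * \prod_(i < n) (x ord0 i - a ord0 i) ^+ k i).
  apply/funext => k; congr (_ * _); apply: eq_bigr => i _.
  by rewrite /dmonomial ffunE ffactn0 subn0 mul1r !mxE.
have F0 x : cube a r x -> dseries a c [ffun=> 0%N] x = f x.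
  move=> /cr/eP/=; rewrite -term0 => fx.
  have FF := @summability.totally_filter {ffun 'I_n -> nat}.
  exact: cvg_lim fx.
exists r, (dseries a c); split => //; first exact: (dseries_tower a r0 cM).
move=> c0 x xa; have aa := cube_center a (ltW r0).
rewrite -(F0 x xa) -(F0 a aa) /dseries !term0.
suff -> : (fun k => c k * \prod_(i < n) (x ord0 i - a ord0 i) ^+ k i) =
    (fun k => c k * \prod_(i < n) (a ord0 i - a ord0 i) ^+ k i) by [].
apply/funext => k.
have [->|k0] := eqVneq k [ffun=> 0%N].
  by congr (_ * _); apply: eq_bigr => i _; rewrite ffunE !expr0.
suff -> : c k = 0 by rewrite !mul0r.
have /eqP := c0 k k0; rewrite (dseries_center a c r0) mulf_eq0 => /orP[/eqP//|].
rewrite prodf_seq_eq0 => /hasP[i _ /=].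
by rewrite pnatr_eq0 -leqn0 leqNgt fact_gt0.
Qed.

(** Successive first-order derivatives along the coordinates listed in [s]; the list records the
    chain on which the inductions below run. *)
Definition bumps n (al : {ffun 'I_n -> nat}) (s : seq 'I_n) :=
  foldl (fun be j => bump_index j be) al s.

Lemma multi_index_bumps n (be : {ffun 'I_n -> nat}) :
  exists s, be = bumps [ffun=> 0%N] s.
Proof.
have [d] := ubnP (\sum_i be i); elim: d be => // d IH be; rewrite ltnS => bed.
have [->|/eqP be0] := eqVneq be [ffun=> 0%N]; first by exists [::].
have /existsP[j jbe] : [exists j, be j != 0%N].
  rewrite -negb_forall; apply: contra_notN be0 => /forallP be0.
  by apply/ffunP => i; rewrite ffunE; apply/eqP.
pose be' := [ffun i => (be i - (i == j))%N].
have be'E : be = bump_index j be'.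
  apply/ffunP => i; rewrite !ffunE; case: eqVneq => [->|_]; last by rewrite subn0 addn0.
  by rewrite subnK// lt0n.
have [|s sE] := IH be'.
  apply: leq_trans bed; rewrite (bigD1 j)//= [ltnRHS](bigD1 j)//= ffunE eqxx.
  rewrite -addSn subn1 prednK ?lt0n// leq_add2l.
  by apply: leq_sum => i /negbTE ij; rewrite ffunE ij subn0.
by exists (rcons s j); rewrite /bumps foldl_rcons -/(bumps _ s) -sE.
Qed.

Section tower_consequences.
Context {R : realType} {n : nat} (a : 'rV[R]_n) (r : R).
Context (F : {ffun 'I_n -> nat} -> 'rV[R]_n -> R).
Hypothesis r0 : 0 < r.
Hypothesis towerF : derivative_tower a r F.
Local Notation mu := (@lebesgue_outer_measure R n).

Lemma tower_neq0_near al : F al a != 0 -> nbhs a [set x | F al x != 0].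
Proof.
move=> Fa; have [L L0 LF] := tower_lipschitz r0 towerF al.
have Fa0 : 0 < `|F al a| by rewrite normr_gt0.
have D0 : 0 < L * n%:R + 1 by rewrite ltr_wpDl// mulr_ge0.
pose e := Num.min r (`|F al a| / 2 / (L * n%:R + 1)).
have e0 : 0 < e by rewrite lt_min r0/= !divr_gt0.
have ec : e * (L * n%:R + 1) <= `|F al a| / 2.
  by rewrite -ler_pdivlMr// ge_min lexx orbT.
apply: filterS (nbhs_cube a e0) => x xa; rewrite /= -normr_gt0.
have xr : cube a r x by move=> i; apply: le_trans (xa i) _; rewrite ge_min lexx.
have := LF a x (cube_center _ (ltW r0)) xr.
have h : \sum_i `|a ord0 i - x ord0 i| <= n%:R * e.
  apply: le_trans (ler_sum _ (_ : forall i, _ -> _ <= e)) _.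
    by move=> i _; rewrite distrC; exact: xa.
  by rewrite sumr_const card_ord -[_ *+ n]mulr_natl.
have := ler_wpM2l L0 h; have := lerB_dist (F al a) (F al x).
rewrite mulrA; lra.
Qed.

(** Induction along the chain. At its end the next derivative is nonzero near [a], so all nearby
    points are regular; before that, zeros of the next term that are regular for it form the
    preimage of the null set [[set 0]]. *)
Lemma tower_nonregular_null al j s : F (bumps al (j :: s)) a != 0 ->
  exists2 V, nbhs a V & mu (V `&` [set x | ~ regular_at (F al) x]) = 0%E.
Proof.
have r20 : 0 < r / 2 by rewrite divr_gt0.
elim: s j al => [|j' s IH] j al Fa.
  exists (cube a (r / 2) `&` [set x | F (bump_index j al) x != 0]).
    by apply: filterI; [exact: nbhs_cube|exact: tower_neq0_near].
  rewrite (_ : _ `&` _ = set0) ?outer_set0//; apply/seteqP; split => // x.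
  by move=> [[xa /= Fx]]; apply; exact: (tower_regular r0 towerF xa Fx).
have [V aV V0] := IH j' (bump_index j al) Fa.
exists (cube a (r / 2) `&` V); first by apply: filterI => //; exact: nbhs_cube.
apply: outer_null_mono (outer_null_setU V0
  (@regular_preimage_null _ _ (F (bump_index j al)) [set 0] _)).
  move=> x [[xa Vx] /= nreg].
  have [reg|] := pselect (regular_at (F (bump_index j al)) x); last by left.
  right; split => //=; apply/eqP; apply: contra_notT nreg.
  exact: (tower_regular r0 towerF xa).
apply: (@outer_null_mono _ _ _ (box 0 0)).
  by move=> y /= y0 i; rewrite (ord1 i) y0 mxE lexx.
apply/eqP; rewrite eq_le outer_ge0 andbT.
apply: le_trans (outer_box_le _ _) _.
by rewrite /box_volume big_ord1 subrr maxxx.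
Qed.

Lemma tower_derivative_of_constant al j p v : cube a (r / 2) p ->
  nbhs p [set x | F al x = v] -> nbhs p [set x | F (bump_index j al) x = 0].
Proof.
move=> pa /nbhs_cubeP[e e0 eP].
have [K [K0 _ KF]] := towerF al.
pose d := Num.min (e / 2) (r / 4).
have d0 : 0 < d by rewrite lt_min; apply/andP; split; exact: divr_gt0.
have de : d <= e / 2 by rewrite ge_min lexx.
have dr : d <= r / 4 by rewrite ge_min lexx orbT.
apply: filterS (nbhs_cube p d0) => x xp /=; apply/eqP; apply: contraT => Gx.
set G := F _ x in Gx; have G0 : 0 < `|G| by rewrite normr_gt0.
(* Moving [x] by [t] along [j] stays in the region of constancy and gives [|G| <= K * t], against
   [t * (2 * K + 1) <= |G|]. *)
pose t := Num.min d (`|G| / (2 * K + 1)).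
have t0 : 0 < t by rewrite lt_min d0 divr_gt0// ltr_wpDl// mulr_ge0.
have td : t <= d by rewrite ge_min lexx.
have tK : t * (2 * K + 1) <= `|G|.
  by rewrite -ler_pdivlMr ?ge_min ?lexx ?orbT// ltr_wpDl// mulr_ge0.
pose y : 'rV[R]_n := \row_i if i == j then x ord0 j + t else x ord0 i.
have yx i : `|y ord0 i - x ord0 i| <= t.
  rewrite mxE; case: eqP => [->|_]; last by rewrite subrr normr0 ltW.
  by rewrite addrAC subrr add0r ger0_norm// ltW.
have yp i : `|y ord0 i - p ord0 i| <= 2 * d.
  by have := ler_distD (x ord0 i) (y ord0 i) (p ord0 i); have := yx i; have := xp i; lra.
have sub (z : 'rV[R]_n) : (forall i, `|z ord0 i - p ord0 i| <= 2 * d) -> cube a r z.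
  move=> zp i; have := ler_distD (p ord0 i) (z ord0 i) (a ord0 i).
  by have := zp i; have := pa i; lra.
have xp2 i : `|x ord0 i - p ord0 i| <= 2 * d by have := xp i; lra.
have := KF j x y (sub x xp2) (sub y yp) _.
rewrite (eP x); last by move=> i; have := xp2 i; lra.
rewrite (eP y); last by move=> i; have := yp i; lra.
have -> : y ord0 j - x ord0 j = t by rewrite mxE eqxx; ring.
rewrite subrr sub0r normrN normrM (ger0_norm (ltW t0)) expr2 mulrCA ler_pM2l// => /(_ _) H.
have {}H : `|G| <= K * t by apply: H => i ij; rewrite mxE (negbTE ij).
have := ler_wpM2l K0 td; nra.
Qed.

(** If a term of the chain is constant near [p], the next one is 0 near [p]. The conclusion is
    shaped for the induction: a nonempty chain would give [v = 0] for its next term, against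
    [v != 0]. One [V] serves all [p], since later the points of local constancy only accumulate at
    [a]. *)
Lemma tower_not_locally_constant al s : F (bumps al s) a != 0 ->
  exists2 V, nbhs a V & forall p v, V p -> nbhs p [set x | F al x = v] ->
    s = [::] /\ v != 0.
Proof.
elim: s al => [|j s IH] al Fa.
  exists [set x | F al x != 0]; first exact: tower_neq0_near.
  by move=> p v /= Fp /nbhs_singleton/= Fv; rewrite -Fv.
have [V aV VP] := IH _ Fa.
exists (cube a (r / 2) `&` V).
  by apply: filterI => //; apply: nbhs_cube; rewrite divr_gt0.
move=> p v [pa Vp] /(tower_derivative_of_constant j pa) /(VP _ _ Vp)[_].
by rewrite eqxx.
Qed.

End tower_consequences.

Section identity_theorem.
Context {R : realType} {n : nat} (U : set 'rV[R]_n) (f : 'rV[R]_n -> R).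
Hypothesis U_connected : connected U.
Hypothesis f_analytic : real_analytic_on U f.
Hypothesis f_nonconstant : forall v, ~ forall u, U u -> f u = v.

(** The interior [C] of a level set has a trace on [U] that is open and closed in [U]; were it
    nonempty, connectedness would make [f] constant on [U]. *)
Lemma analytic_not_locally_constant a v : U a -> ~ nbhs a [set x | f x = v].
Proof.
move=> Ua av; pose C : set 'rV[R]_n := interior [set x | f x = v].
suff CU : U `&` C = U.
  by case: (@f_nonconstant v) => u; rewrite -CU => -[_ /nbhs_singleton].
apply: U_connected.
- by exists a.
- by exists C => //; exact: open_interior.
exists (closure (U `&` C)); first exact: closed_closure.
apply/seteqP; split=> [x [Ux Cx]|p [Up pC]].
  by split => //; apply: subset_closure.
split => //.
have [r [F [r0 towerF F0 Fconst]]] := analytic_tower f_analytic Up.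
have r20 : 0 < r / 2 by rewrite divr_gt0.
(* For [p] in the closure, either [f] is constant near [p], with the value [v] taken at nearby
   points of [C], or some derivative is nonzero at [p] and excludes local constancy at those
   points. *)
have [all0|] := pselect (forall al, al != [ffun=> 0%N] -> F al p = 0).
  have fp := Fconst all0.
  have [x [[_ /nbhs_singleton/= fx] xp]] := pC _ (nbhs_cube p r0).
  by apply: filterS (nbhs_cube p r0) => y yp; rewrite /= (fp y yp) -(fp x xp).
move=> /existsNP[be /not_implyP[be0 /eqP Fbe]]; exfalso.
have [s sE] := multi_index_bumps be; rewrite sE in be0 Fbe.
have [V pV VP] := tower_not_locally_constant r0 towerF Fbe.
have [x [[_ Cx] [xp Vx]]] := pC _ (filterI (nbhs_cube p r20) pV).
have : nbhs x [set y | F [ffun=> 0%N] y = v].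
  apply: filterS (filterI Cx (nbhs_cube x r20)) => y [/= <- yx]; apply: F0 => i.
  by have := ler_distD (x ord0 i) (y ord0 i) (p ord0 i); have := yx i; have := xp i; lra.
by move=> /(VP _ _ Vx)[s0]; rewrite s0 eqxx in be0.
Qed.

Lemma analytic_preimage_null (N : set R) :
  lebesgue_outer_measure [set y : 'rV[R]_1 | N (y ord0 ord0)] = 0%E ->
  lebesgue_outer_measure (U `&` [set x | N (f x)]) = 0%E.
Proof.
move=> N0; apply: outer_null_local => a [Ua _].
have [r [F [r0 towerF F0 Fconst]]] := analytic_tower f_analytic Ua.
(* Otherwise [f] would be constant near [a]. *)
have [be be0 Fbe] : exists2 be, be != [ffun=> 0%N] & F be a != 0.
  apply: contrapT => h; apply: (@analytic_not_locally_constant a (f a) Ua).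
  apply: filterS (nbhs_cube a r0) => x xa /=; apply: Fconst xa => al al0.
  by apply/eqP; apply: contra_notT h => Fal; exists al.
(* Positive order makes the chain nonempty, so it has a first step from [F [ffun=> 0%N]], which is
   [f] near [a]. *)
have [[|j s] sE] := multi_index_bumps be; first by rewrite sE eqxx in be0.
rewrite sE in Fbe.
have [V aV V0] := tower_nonregular_null r0 towerF Fbe.
exists (cube a r `&` V); first by apply: filterI => //; exact: nbhs_cube.
apply: outer_null_mono (outer_null_setU V0 (regular_preimage_null (F [ffun=> 0%N]) N0)).
move=> x [[xa Vx] [Ux Nx]].
have [reg|] := pselect (regular_at (F [ffun=> 0%N]) x); last by left.
by right; split => //; rewrite /= F0.
Qed.

End identity_theorem.

(** * Sums over smooth integers *)

Lemma subset_esum (R : realType) (I : choiceType) (D E : set I)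
    (a : I -> \bar R) : D `<=` E -> (forall i, 0 <= a i)%E ->
  (\esum_(i in D) a i <= \esum_(i in E) a i)%E.
Proof.
move=> DE a0; rewrite esum_mkcond [leRHS]esum_mkcond; apply: le_esum => i _.
case: ifPn => [/set_mem/DE/mem_set -> //|_]; by case: ifP.
Qed.

Lemma esum_inj_le (R : realType) (I J : choiceType) (D : set I) (E : set J)
    (e : I -> J) (a : I -> \bar R) (b : J -> \bar R) :
  set_inj D e -> (forall i, D i -> E (e i)) -> (forall i, D i -> a i = b (e i)) ->
  (forall j, 0 <= b j)%E ->
  (\esum_(i in D) a i <= \esum_(j in E) b j)%E.
Proof.
move=> einj eDE ab b0; rewrite (eq_esum ab) -(esum_image _ _ b einj).
by apply: subset_esum => // _ [i Di <-]; exact: eDE.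
Qed.

Lemma esum_geometric_le (R : realType) (z : R) : 0 <= z -> z < 1 ->
  (\esum_(v in [set: nat]) (z ^+ v)%:E <= ((1 - z)^-1)%:E)%E.
Proof.
move=> z0 z1; rewrite -nneseries_esumT; last by move=> v; rewrite lee_fin exprn_ge0.
apply: lime_le; first by apply: is_cvg_nneseries => v _ _; rewrite lee_fin exprn_ge0.
apply: nearW => k; rewrite sumEFin lee_fin big_mkord.
have D0 : 0 < 1 - z by rewrite subr_gt0.
rewrite -[leRHS]mul1r ler_pdivlMr// mulrC.
have := subrX1 z k; rewrite -opprB -[z - 1]opprB mulNr => /oppr_inj <-.
by rewrite gerBl exprn_ge0.
Qed.

Definition smooth (s : seq nat) : set nat :=
  [set m | (0 < m)%N /\ forall p, prime p -> (p %| m)%N -> p \in s].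

Section smooth_sums.
Context {R : realType} (eps : R).
Hypothesis eps_gt0 : 0 < eps.

Lemma prime_powRN_lt1 (p : nat) : prime p -> p%:R `^ (- eps) < 1.
Proof.
move=> /prime_gt1 p1; rewrite powRN invf_lt1 ?powR_gt0 ?ltr0n ?(ltnW p1)//.
have := @gt0_ltr_powR R eps eps_gt0 1 p%:R; rewrite powR1; apply; rewrite ?nnegrE ?ltr1n //.
Qed.

(** Euler product bound, by induction on [s]: splitting off the power of [p] injects the new smooth
    numbers into pairs of an exponent and an old smooth number, and the exponents give a geometric
    series of ratio [z < 1]. *)
Lemma smooth_sum_bounded (s : seq nat) : all prime s -> exists2 K : R, 0 <= K &
  (\esum_(m in smooth s) (m%:R `^ (- eps))%:E <= K%:E)%E.
Proof.
elim: s => [_|p s IH /= /andP[pp /IH[K K0 sK]]].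
  exists 1 => //.
  have -> : 1%:E = (\esum_(m in [set 1%N]) (m%:R `^ (- eps))%:E)%E :> \bar R.
    by rewrite esum_set1 ?powR1 ?lee_fin.
  apply: subset_esum => [m [m0 mP]|m]; last by rewrite lee_fin powR_ge0.
  apply/eqP; rewrite eqn_leq m0 andbT leqNgt; apply/negP => m1.
  by have := mP _ (pdiv_prime m1) (pdiv_dvd m).
pose z : R := p%:R `^ (- eps).
have z0 : 0 <= z by exact: powR_ge0.
have z1 : z < 1 by exact: prime_powRN_lt1.
exists (K * (1 - z)^-1); first by rewrite mulr_ge0// invr_ge0 subr_ge0 ltW.
pose b (vm : nat * nat) : \bar R := (z ^+ vm.1 * vm.2%:R `^ (- eps))%:E.
have b0 vm : (0 <= b vm)%E by rewrite lee_fin mulr_ge0 ?exprn_ge0 ?powR_ge0.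
pose e m := (logn p m, (m %/ p ^ logn p m)%N).
have eK m : m = (p ^ (e m).1 * (e m).2)%N.
  by rewrite /e/= mulnC divnK// pfactor_dvdnn.
apply: le_trans (@esum_inj_le _ _ _ _ ([set: nat] `*`` (fun=> smooth s)) e _ b _ _ _ b0) _.
- by move=> m m' _ _ ee; rewrite (eK m) (eK m') ee.
- move=> m [m0 mP]; split => //=; split.
    by rewrite divn_gt0 ?expn_gt0 ?prime_gt0// dvdn_leq// pfactor_dvdnn.
  move=> l lp; rewrite -[(_ %/ _)%N]/((e m).2) => lm.
  have := mP l lp; rewrite {1}(eK m) dvdn_mull// => /(_ isT).
  rewrite inE => /orP[/eqP lE|//]; rewrite {}lE in lm lp *.
  (* If [p] divided the cofactor, the valuation of [m] at [p] would be larger than [logn p m]. *)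
  have : (p ^ (logn p m).+1 %| m)%N by rewrite {2}(eK m) expnSr dvdn_mul.
  by rewrite pfactor_dvdn// ltnn.
- move=> m _; congr (_%:E); rewrite {1}(eK m) natrM powRM// natrX; congr (_ * _).
  by rewrite -powR_mulrn// powRAC powR_mulrn.
rewrite -(esum_esum (a := fun v m => b (v, m)))//.
apply: (@le_trans _ _ (\esum_(v in [set: nat]) (K * z ^+ v)%:E)%E).
  apply: le_esum => v _.
  apply: le_trans (esumZl_le _ (exprn_ge0 v z0) _) _; first by move=> m; exact: powR_ge0.
  by rewrite mulrC EFinM lee_wpmul2l// lee_fin exprn_ge0.
apply: le_trans (esumZl_le _ K0 _) _; first by move=> v; exact: exprn_ge0.
by rewrite EFinM lee_wpmul2l// ?lee_fin// esum_geometric_le.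
Qed.

(** The integer 0 is excluded because some prime exceeds every entry of [s]. *)
Lemma prime_factors_in_smooth (s : seq nat) (q : int) :
  prime_factors_in [set` s] q -> smooth s `|q|%N.
Proof.
move=> qs; split => //; rewrite lt0n absz_eq0; apply/eqP => q0.
have [p mp pp] := prime_above (\max_(i <- s) i).
have := qs p pp; rewrite q0 dvdn0 => /(_ isT)/= ps.
by move: mp; rewrite ltnNge (leq_bigmax_seq (F := id)).
Qed.

Lemma prime_factors_in_sum (s : seq nat) : all prime s ->
  (\esum_(q in prime_factors_in [set` s]) (`|q%:~R : R| `^ (- eps))%:E < +oo)%E.
Proof.
move=> /smooth_sum_bounded[K K0 sK].
pose b (tm : bool * nat) : \bar R := (tm.2%:R `^ (- eps))%:E.
pose e (q : int) := (q < 0, `|q|%N).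
apply: le_lt_trans (@esum_inj_le _ _ _ _ ([set: bool] `*`` (fun=> smooth s)) e _ b _ _ _ _) _.
- by move=> q q' _ _ []; lia.
- by move=> q qs; split => //; exact: prime_factors_in_smooth.
- by move=> q _; rewrite /b/= -intr_norm -abszE.
- by move=> tm; rewrite lee_fin powR_ge0.
rewrite -(esum_esum (a := fun t m => b (t, m))); last by move=> *; rewrite lee_fin powR_ge0.
apply: (@le_lt_trans _ _ (\esum_(t in [set: bool]) K%:E)%E).
  by apply: le_esum => t _.
by rewrite (@esum_finType _ _ (fun=> K))// ltry.
Qed.

End smooth_sums.

(** A finite [A] carries all but [e] of the sum, and a point lying in infinitely many [E i] lies in
    one with [i] outside [A]. *)
Lemma outer_borel_cantelli (R : realType) (n : nat) (I : countType) (D : set I)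
    (E : I -> set 'rV[R]_n) (w : I -> R) : (forall i, 0 <= w i) ->
  (forall i, D i -> lebesgue_outer_measure (E i) <= (w i)%:E)%E ->
  (\esum_(i in D) (w i)%:E < +oo)%E ->
  lebesgue_outer_measure [set x | infinite_set [set i | D i /\ E i x]] = 0%E.
Proof.
move=> w0 Ew woo; apply/eqP; rewrite eq_le outer_ge0 andbT.
apply/lee_addgt0Pr => e e0; rewrite add0e.
have wfin : (\esum_(i in D) (w i)%:E)%E \is a fin_num.
  by rewrite ge0_fin_numE// esum_ge0// => i _; rewrite lee_fin.
have [_ [A [finA AD] <-]] := ub_ereal_sup_adherent e0 wfin.
rewrite -/(esum D (fun i => (w i)%:E)) (esumID A); last by move=> i _; rewrite lee_fin.
rewrite (setIidr AD) (esum_fset finA); last by move=> i _; rewrite lee_fin.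
set WA := (\sum_(i \in A) _)%E; set WD := (\esum_(i in _ `&` _) _)%E => WAD.
have WDe : (WD <= e%:E)%E.
  move: wfin WAD; rewrite (esumID A); last by move=> i _; rewrite lee_fin.
  rewrite (setIidr AD) (esum_fset finA); last by move=> i _; rewrite lee_fin.
  rewrite -/WA -/WD; case: WA => [u| |]; case: WD => [v| |] //= _.
  by rewrite -!EFinD lte_fin lee_fin; lra.
apply: le_trans WDe.
apply: (@le_trans _ _ (lebesgue_outer_measure (\bigcup_(i in D `&` ~` A) E i))).
  apply: outer_mono => x /= xinf; apply: contrapT => nx; apply: xinf.
  apply: sub_finite_set finA => i [Di Ex]; apply: contrapT => nA.
  by apply: nx; exists i.
apply: le_trans (outer_subadditive _ _) _.
by apply: le_esum => i [Di _]; exact: Ew.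
Qed.

(** * Approximation of real numbers *)

Section well_approximable.
Context {R : realType} (eps : R).

Definition approximates (q : int) (y : R) :=
  exists p : int, `|q%:~R * y - p%:~R| < `|q%:~R : R| `^ (- eps).

Lemma norm_intr_ge1 (q : int) : q != 0 -> 1 <= `|q%:~R : R|.
Proof. by move=> q0; rewrite -intr_norm ler1z -gtz0_ge1 normr_gt0. Qed.

Lemma powRN_le1 (q : int) : 0 < eps -> q != 0 -> `|q%:~R : R| `^ (- eps) <= 1.
Proof.
move=> e0 q0; rewrite powRN invf_le1 ?powR_gt0 ?normr_gt0 ?intr_eq0//.
rewrite -[X in X <= _](powRr0 `|q%:~R|).
by apply: ler_powR; [exact: norm_intr_ge1|exact: ltW].
Qed.

Lemma intr_le_truncn (p : int) (x : R) : `|p%:~R| <= x -> (`|p| <= Num.truncn x)%N.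
Proof.
move=> px; rewrite truncn_ge_nat; last exact: le_trans px.
by rewrite -[_%:R]/(`|p|%N%:~R) abszE intr_norm.
Qed.

(* Only the [p] with [|p| <= M |q| + 1] matter, and each of them contributes an
   interval of length [2 |q| ^ (- 1 - eps)]. *)
Lemma outer_approximates (M : nat) (q : int) : 0 < eps -> q != 0 ->
  (lebesgue_outer_measure [set y : 'rV[R]_1 |
     (`|y ord0 ord0| <= M%:R)%R /\ approximates q (y ord0 ord0)] <=
   (2 * (2 * M%:R + 3) * `|q%:~R| `^ (- eps))%:E)%E.
Proof.
move=> e0 q0; set N := `|q%:~R : R|; set dl := N `^ (- eps).
have N1 : 1 <= N by exact: norm_intr_ge1.
have N0 : 0 < N by exact: lt_le_trans N1.
have dl1 : dl <= 1 by exact: powRN_le1.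
have dl0 : 0 <= dl by exact: powR_ge0.
pose T := Num.truncn (N * M%:R + 1).
have NM0 : 0 <= N * M%:R + 1 by rewrite addr_ge0// mulr_ge0// ltW.
have TN : T%:R <= N * M%:R + 1 by rewrite truncn_le.
(* The index [i] encodes the numerator [p = i - T], which runs from [-T] to [T]. *)
pose c (i : 'I_(T + T).+1) : R := (i%:R - T%:R) / q%:~R.
pose B (i : 'I_(T + T).+1) : set 'rV[R]_1 :=
  box (const_mx (c i - dl / N)) (const_mx (c i + dl / N)).
apply: (@le_trans _ _ (lebesgue_outer_measure
    (\bigcup_(i in [set: 'I_(T + T).+1]) B i))).
  apply: outer_mono => y [/= yM [p yp]].
  have pT : (`|p| <= T)%N.
    apply: intr_le_truncn.
    have := lerB_dist (p%:~R) (q%:~R * y ord0 ord0); rewrite distrC normrM -/N.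
    have := ler_wpM2l (ltW N0) yM; move: yp; rewrite -/N -/dl; lra.
  have iP : (`|(p + T%:Z)%R| < (T + T).+1)%N by lia.
  exists (Ordinal iP) => // k; rewrite (ord1 k) !mxE /c/=.
  have -> : `|(p + T%:Z)%R|%N%:R - T%:R = p%:~R :> R.
    rewrite -[X in X - _]/(`|(p + T%:Z)%R|%N%:~R) gez0_abs; last by lia.
    by rewrite intrD addrK.
  rewrite -ler_distl -(ler_pM2l N0) mulrCA divff ?gt_eqF// mulr1 -normrM.
  by rewrite mulrBr mulrCA divff ?intr_eq0// mulr1 ltW.
apply: le_trans (outer_subadditive _ _) _.
apply: (@le_trans _ _ (\esum_(i in [set: 'I_(T + T).+1]) (2 * dl / N)%:E)%E).
  apply: le_esum => i _; apply: le_trans (outer_box_le _ _) _.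
  have dN0 : 0 <= dl / N by rewrite divr_ge0// ltW.
  by rewrite /box_volume big_ord1 !mxE lee_fin ge_max; apply/andP; split; lra.
rewrite (@esum_finType _ _ (fun=> 2 * dl / N)); last first.
  by move=> _; rewrite divr_ge0 ?mulr_ge0// ltW.
rewrite sumr_const card_ord lee_fin -[_ *+ (T + T).+1]mulr_natr.
rewrite -[(T + T).+1%:R]natr1 natrD mulrAC ler_pdivrMr//.
(* What remains is [2 * T + 1 <= (2 * M + 3) * N], from [T <= N * M + 1] and [1 <= N]. *)
rewrite [leRHS](_ : _ = 2 * dl * ((2 * M%:R + 3) * N)); last by ring.
by rewrite ler_wpM2l ?mulr_ge0//; lra.
Qed.

(** The bound of [outer_approximates] depends on the size of [y], so Borel-Cantelli is applied to
    each region [|y| <= M] and the countably many null sets are united. *)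
Lemma approximable_null (S : set nat) : 0 < eps -> finite_set S ->
  (forall l, S l -> prime l) ->
  lebesgue_outer_measure [set y : 'rV[R]_1 |
    infinite_set [set q | prime_factors_in S q /\ approximates q (y ord0 ord0)]] = 0%E.
Proof.
move=> e0 /finite_seqP[s ->] sP.
have ps : all prime s by apply/allP => l /sP.
apply: (@outer_null_mono _ _ _ (\bigcup_(M in [set: nat])
   [set y | infinite_set [set q | prime_factors_in [set` s] q /\
     ((`|y ord0 ord0| <= M%:R)%R /\ approximates q (y ord0 ord0))]])).
  move=> y yinf; exists (Num.truncn `|y ord0 ord0|).+1 => //= yfin; apply: yinf.
  apply: sub_finite_set yfin => q [qs qy]; do 2!split => //.
  by rewrite ltW// truncnS_gt.
apply: outer_null_bigcup => M _.
pose w (q : int) : R := 2 * (2 * M%:R + 3) * `|q%:~R| `^ (- eps).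
have C0 : 0 <= 2 * (2 * M%:R + 3) :> R by rewrite mulr_ge0// addr_ge0// mulr_ge0.
apply: (outer_borel_cantelli (w := w)).
- by move=> q; rewrite mulr_ge0// powR_ge0.
- move=> q /prime_factors_in_smooth[q0 _]; apply: outer_approximates => //.
  by rewrite -absz_eq0 -lt0n.
apply: le_lt_trans (esumZl_le _ C0 _) _; first by move=> q; exact: powR_ge0.
have := prime_factors_in_sum e0 ps.
set W := (\esum_(q in _) _)%E => Woo.
have : (0 <= W)%E by apply: esum_ge0 => q _; rewrite lee_fin powR_ge0.
by case: W Woo => [u| |]// _ _; rewrite -EFinM ltry.
Qed.

End well_approximable.

(** * Reduction of the theorem to one coordinate function *)

Lemma finite_bounded_int_vectors (d T : nat) :
  finite_set [set p : 'rV[int]_d | forall i, (`|p ord0 i| <= T)%N].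
Proof.
pose h (v : 'rV['I_(T + T).+1]_d) : 'rV[int]_d := map_mx (fun i : 'I_(T + T).+1 => i%:Z - T%:Z) v.
apply: (@sub_finite_set _ _ (h @` setT)); last first.
  by apply: finite_image; exact: finite_finset.
move=> p pT; have iP i : (`|(p ord0 i + T%:Z)%R| < (T + T).+1)%N.
  by have := pT i; lia.
exists (\row_i Ordinal (iP i)) => //; apply/rowP => i; rewrite !mxE/=.
by rewrite gez0_abs ?addrK//; have := pT i; lia.
Qed.

Theorem theorem3p2 (R : realType) (S : set nat)
    (S_finite : finite_set S) (S_prime : forall l, S l -> prime l)
    (n d : nat) (d_gt0 : (0 < d)%N)
    (U : set 'rV[R]_n) (U_open : open U) (U_connected : connected U)
    (f : 'I_d -> 'rV[R]_n -> R)
    (f_analytic : forall i, real_analytic_on U (f i))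
    (f_indep : lin_indep_with_1 U f)
    (eps : R) (eps_gt0 : 0 < eps) :
  lebesgue_ae_on U (fun u =>
    finite_set [set pq : 'rV[int]_d * int |
      prime_factors_in S pq.2 /\
      ~ (`|pq.2%:~R : R| `^ (- eps) <=
         \big[Num.max/0]_(i < d) `|pq.2%:~R * f i u - (pq.1 ord0 i)%:~R|)]).
Proof.
pose i0 := Ordinal d_gt0.
(* A constant value [v] of [f i0] would be the linear relation with constant term [- v] and
   coefficient 1 at [i0]. *)
have f0_nonconstant v : ~ forall u, U u -> f i0 u = v.
  move=> fv; have [|_ /(_ i0)/eqP] := f_indep (- v) (fun i => (i == i0)%:R).
    move=> u Uu; rewrite (bigD1 i0)//= ?eqxx mul1r fv// big1 ?addr0 ?addNr//.
    by move=> i /negbTE ->; rewrite mul0r.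
  by rewrite eqxx oner_eq0.
pose N (y : R) := infinite_set [set q | prime_factors_in S q /\ approximates eps q y].
apply: outer_null_mono (analytic_preimage_null (N := N) U_connected
  (f_analytic i0) f0_nonconstant (approximable_null eps_gt0 S_finite S_prime)).
move=> u [Uu ninf]; split => //= Qfin; apply: ninf.
set Q := [set q | _] in Qfin.
(* For a given [q], every coordinate of an exceptional [p] lies within 1 of [q * f i u], so [T q]
   leaves finitely many [p]. Finitely many [q] thus give finitely many exceptional pairs. *)
pose T (q : int) := (\max_(i < d) Num.truncn (`|q%:~R * f i u| + 1)%R)%N.
apply: (@sub_finite_set _ _ (\bigcup_(q in Q)
    ([set p : 'rV[int]_d | forall i, (`|p ord0 i| <= T q)%N] `*` [set q]))).
  move=> [p q] [/= qS /negP]; rewrite -ltNge => lt.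
  have close i : `|q%:~R * f i u - (p ord0 i)%:~R| < `|q%:~R : R| `^ (- eps).
    by apply: le_lt_trans lt; exact: le_bigmax.
  exists q; first by split => //; exists (p ord0 i0).
  split => //= i; apply: leq_trans (leq_bigmax i); apply: intr_le_truncn.
  have q0 : q != 0.
    have /finite_seqP[s sE] := S_finite.
    by move: qS; rewrite sE => /prime_factors_in_smooth[]; rewrite lt0n absz_eq0.
  have := lerB_dist ((p ord0 i)%:~R : R) (q%:~R * f i u); rewrite distrC.
  have := close i; have := powRN_le1 eps_gt0 q0; lra.
apply: bigcup_finite => // q _; apply: finite_setX => //.
exact: finite_bounded_int_vectors.
Qed.
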